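(* Let $m$ be a positive integer, $q=2^m$, and $F=\mathbb{F}_q$. Let $b,c\in F$, and put $k_1=b^2+c+1$ and $k_2=b^2+b+c+\sqrt{c}$. If $k_1k_2\neq 0$, then $$K(k_1k_2)=K(k_1k_2+k_2).$$
   Context: $F=\mathbb{F}_q$ is the finite field with $q=2^m$ elements, $F^*=F\setminus\{0\}$, and $\mathrm{Tr}$ is the absolute trace function of $F$ over $\mathbb{F}_2$. For $a\in F^*$ the Kloosterman sum is $K(a)=\sum_{x\in F^*}(-1)^{\mathrm{Tr}(ax+1/x)}$. For $c\in F$, $\sqrt{c}$ denotes the unique element of $F$ whose square is $c$. *)

(* Defs.v *)
From mathcomp Require Import all_boot all_order all_fingroup all_algebra.
From mathcomp Require Import all_solvable all_field.

Set Implicit Arguments.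
Unset Strict Implicit.
Unset Printing Implicit Defensive.

Import GRing.Theory.
Local Open Scope ring_scope.

Section BinaryField.

Variables (F : finFieldType) (m : nat) (cardF : #|F| = (2 ^ m)%N).

(* F itself, carrying its canonical structure of extension of 'F_2. *)
Definition binField : splittingFieldType 'F_2 :=
  pPrimeCharType (card_finPcharP cardF isT).

(* The trace of F over its prime field. Its value, an element of the prime    *)
(* field, is returned as an element of F; see absTrace_bool.                  *)
Definition absTrace (x : F) : F :=
  galTrace 1%AS {:binField}%AS (x : binField).

(* The exponent is the boolean Tr(ax + 1/x) <> 0, i.e. the representative in  *)
(* {0, 1} of the trace. The formula also makes sense for a = 0.               *)
Definition Kloosterman (a : F) : int :=
  \sum_(x : F | x != 0) (-1) ^+ (absTrace (a * x + x^-1) != 0).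

Lemma absTraceE x : absTrace x = \sum_(i < m) x ^+ (2 ^ i).
Proof.
have dimL : \dim {:binField} = m.
  by rewrite (pprimeChar_dimf (card_finPcharP cardF isT)) [#|_|]cardF pfactorK.
have sub1L : (1%AS <= {:binField}%AS)%VS by exact: sub1v.
have [alpha /eqP gen_alpha frob] := finField_galois_generator sub1L.
have ord_alpha : #[alpha]%g = m.
  rewrite orderE -gen_alpha -galois_dim ?dimv1 ?divn1 //.
  exact: finField_galois.
have frobX i : (alpha ^+ i)%g (x : binField) = (x : binField) ^+ (2 ^ i).
  elim: i => [|i IHi]; first by rewrite gal_id.
  rewrite expgSr galM ?memvf // IHi frob ?memvf //.
  by rewrite dimv1 expn1 card_Fp // -exprM -expnSr.
have cycE : 'Gal({:binField} / 1)%g = [set (alpha ^+ i)%g | i : 'I_m].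
  rewrite gen_alpha; apply/setP=> u; apply/idP/imsetP => [|[i _ ->]].
    by case/cyclePmin=> i; rewrite ord_alpha => lt_i ->; exists (Ordinal lt_i).
  exact: mem_cycle.
rewrite /absTrace /galTrace cycE big_imset /=; first exact: eq_bigr.
move=> i j _ _ /eqP; rewrite eq_expg_mod_order ord_alpha !modn_small //.
by move/eqP/val_inj.
Qed.

Lemma absTrace_bool x : absTrace x = (absTrace x != 0)%:R.
Proof.
have /vlineP[k] : (absTrace x : binField) \in 1%VS.
  by apply: mem_galTrace; rewrite ?memvf //; apply/finField_galois/sub1v.
have {k}[->|->] : k = 0 \/ k = 1 :> 'F_2.
- by case: k => [[|[|//]] ?]; [left|right]; apply: val_inj.
- by rewrite scale0r => ->; rewrite eqxx.
- by rewrite scale1r => ->; rewrite oner_eq0.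
Qed.

End BinaryField.

(* The element s with s ^+ 2 = c, whose existence and uniqueness hold in      *)
(* characteristic 2 by fsqrtK and fsqrt_unique; the default 0 is then unused. *)
Definition fsqrt (F : finFieldType) (c : F) : F :=
  odflt 0 [pick s : F | s ^+ 2 == c].

Lemma fsqrt_unique (F : finFieldType) (s t : F) :
  2%N \in [pchar F] -> s ^+ 2 = t ^+ 2 -> s = t.
Proof. by move=> ch2; apply: (fmorph_inj (pFrobenius_aut ch2)). Qed.

Lemma fsqrtK (F : finFieldType) (c : F) :
  2%N \in [pchar F] -> fsqrt c ^+ 2 = c.
Proof.
move=> ch2; rewrite /fsqrt; case: pickP => [s /eqP // | no_root].
have inj2 : injective (fun s : F => s ^+ 2).
  by move=> s t /(fsqrt_unique ch2).
have := f_invF inj2 c; set s := invF _ _ => sc.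
by have := no_root s; rewrite sc eqxx.
Qed.

(* Main.v *)
Require Import Defs.
From mathcomp Require Import all_boot all_order all_algebra all_field.
From mathcomp Require Import ring.

Import GRing.Theory.
Local Open Scope ring_scope.

Set Implicit Arguments.
Unset Strict Implicit.
Unset Printing Implicit Defensive.

(** With t = b + sqrt c one has k1 = (t + 1)^2 and k2 = t (t + 1), so that the
    claim is K(t (t + 1)^3) = K(t^3 (t + 1)) for t distinct from 0 and 1. It
    says that two elliptic curves joined by an isogeny of degree 3 have equally
    many rational points; the proof makes this elementary.

    The substitution x -> x / a turns K(a) into the sum of (-1)^Tr(x + a/x)
    over x <> 0, and Tr(x + a/x) = 0 means that x is the abscissa of a rational
    point of E_a : y^2 + xy = x^3 + a^2. For a = t^3 (t + 1), the element t^2 is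
    the abscissa of two points of order 3 on E_a. Dividing by the subgroup that
    they generate leads to E_a' with a' = t (t + 1)^3, and acts on abscissas by
      R(x) = x ((x + t^2 + t) / (x + t^2))^2.
    This map preserves the trace of x + a/x (absTrace_isog). Whether a fibre of
    R has one rational point or else none or three depends on the quadratic
    resolvent of a cubic, and this resolvent turns out to be governed by the
    same trace: two rational points x in one fibre force Tr(x + a/x) = Tr(t).

    Hence R is injective from the level set Tr(x + a/x) = Tr(t) + 1 to the set
    Tr(x + a'/x) = Tr(t) + 1 (isog_inj). As K(a) is determined by the size of
    either level set, it remains to see that these two are equipotent.
    Replacing t by t + 1 exchanges a and a', and Tr(t) with Tr(t) + Tr(1). If
    Tr(1) = 0, this gives an injection the other way. If Tr(1) = 1, it only
    gives the same inequality for the complementary level sets; but then F has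
    no primitive cube root of unity, cubing is bijective, and Cardano's formula
    solves R(x) = x', so that R is also surjective (isog_surj). *)

Section KloostermanIdentity.

Variables (m : nat) (F : finFieldType) (cardF : #|F| = (2 ^ m)%N).

Local Notation Tr := (absTrace cardF).

Let char2 : 2%N \in [pchar F] := card_finPcharP cardF isT.
Let two0 : 2%:R = 0 :> F := pcharf0 char2.
(* The normal forms of ring and field have integer coefficients; rewriting    *)
(* 2 to 0 and 3 to 1 lets these tactics compare them in characteristic 2.     *)
Let three1 : 3%:R = 1 :> F.
Proof. by rewrite -[3%N]/(2 + 1)%N natrD two0 add0r. Qed.

(** * The absolute trace *)

Lemma char2_eq (x y : F) : x + y = 0 -> x = y.
Proof. by move/eqP; rewrite addr_eq0 oppr_pchar2 // => /eqP. Qed.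

Lemma absTraceD : {morph Tr : x y / x + y}.
Proof.
move=> x y; rewrite !absTraceE -big_split; apply: eq_bigr => i _.
by rewrite exprDn_pchar // (eq_pnat _ (pcharf_eq char2)) pnatX pnat_id.
Qed.

Lemma absTrace_sqr x : Tr (x ^+ 2) = Tr x.
Proof.
rewrite !absTraceE; case: (m) cardF => [|n] cardFn; first by rewrite !big_ord0.
rewrite big_ord_recr [RHS]big_ord_recl /= addrC expr1 -exprM -expnS -cardFn.
rewrite expf_card; congr (_ + _); apply: eq_bigr => i _.
by rewrite -exprM -expnS.
Qed.

Lemma absTrace01 x : Tr x = 0 \/ Tr x = 1.
Proof. by rewrite absTrace_bool; case: (_ != 0); [right | left]. Qed.

Lemma absTrace_ArtinSchreier w : Tr (w ^+ 2 + w) = 0.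
Proof. by rewrite absTraceD absTrace_sqr addrr_pchar2. Qed.

(** Additive Hilbert 90, by counting: w^2 + w takes each of its values at most
    twice, hence takes at least q/2 values; all of them have trace 0, and the
    trace, a polynomial of degree q/2, has no more roots than that. *)
Lemma absTrace_Hilbert90 z : Tr z = 0 -> exists w, z = w ^+ 2 + w.
Proof.
pose f (w : F) := w ^+ 2 + w; pose K := [set z | Tr z == 0].
have m_gt0 : (0 < m)%N.
  by case: (m) cardF => // /eqP; rewrite gtn_eqF // finNzRing_gt1.
have cardK : (#|K| <= 2 ^ m.-1)%N.
  pose T : {poly F} := \sum_(i < m) 'X^(2 ^ i).
  have sizeT : size T = (2 ^ m.-1).+1.
    rewrite /T -(prednK m_gt0) big_ord_recr /= addrC size_polyDl size_polyXn //.
    rewrite ltnS; apply: (leq_trans (size_sum _ _ _)).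
    by apply/bigmax_leqP=> i _; rewrite size_polyXn ltn_exp2l.
  have T0 : T != 0 by rewrite -size_poly_eq0 sizeT.
  rewrite cardE -ltnS -sizeT; apply: max_poly_roots => //; last exact: enum_uniq.
  apply/allP=> x; rewrite mem_enum inE absTraceE /root => /eqP <-.
  rewrite horner_sum; apply/eqP; apply: eq_bigr => i _.
  by rewrite hornerXn.
have subK : f @: [set: F] \subset K.
  by apply/subsetP=> _ /imsetP[w _ ->]; rewrite inE absTrace_ArtinSchreier.
have card_f : (#|F| <= 2 * #|f @: [set: F]|)%N.
  rewrite -cardsT -sum1_card (partition_big_imset f) /=.
  rewrite mulnC -sum_nat_const; apply: leq_sum => _ /imsetP[w _ ->].
  apply: (@leq_trans #|[set w; w + 1]|); last by rewrite cards2 ltnS leq_b1.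
  rewrite sum1_card; apply/subset_leq_card/subsetP=> w' /andP[_ /eqP fw'].
  rewrite !inE.
  have : (w' + w) * (w' + (w + 1)) = f w' + f w by rewrite /f; ring: two0.
  rewrite fw' addrr_pchar2 // => /eqP; rewrite mulf_eq0.
  by case/orP=> /eqP/char2_eq->; rewrite eqxx ?orbT.
move=> Trz0; suff: z \in f @: [set: F] by case/imsetP=> w _ ->; exists w.
suff /eqP -> : f @: [set: F] == K by rewrite inE Trz0.
rewrite eqEcard subK (leq_trans cardK) //.
by rewrite -(leq_pmul2l (isT : 0 < 2)%N) -expnS prednK // -cardF.
Qed.

(** * Kloosterman sums and level sets of the trace *)

Definition traceLevel (a e : F) := [set x | (x != 0) && (Tr (x + a / x) == e)].

(** Both level sets are allowed because the isogeny controls only one of them,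
    the one that depends on Tr(t). *)
Lemma Kloosterman_traceLevel a e : a != 0 -> e = 0 \/ e = 1 ->
  Kloosterman cardF a =
  (-1) ^+ (e != 0) * (#|traceLevel a e|%:R *+ 2 - #|[set x : F | x != 0]|%:R).
Proof.
move=> a0 e01; rewrite /Kloosterman.
rewrite (reindex_inj (mulfI (invr_neq0 a0))) /=.
rewrite (eq_bigl (fun x => x != 0)); last first.
  by move=> x; rewrite mulf_eq0 invr_eq0 (negPf a0).
transitivity (\sum_(x : F | x != 0)
    (-1) ^+ (e != 0) * ((Tr (x + a / x) == e)%:R *+ 2 - 1) : int).
  apply: eq_bigr => x _; rewrite mulVKf // invfM invrK.
  by case: e01 => ->; case: (absTrace01 (x + a / x)) => ->;
    rewrite ?eqxx ?oner_eq0 // eq_sym oner_eq0.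
rewrite -mulr_sumr sumrB sumr_const sumrMnl -natr_sum.
congr (_ * (_ *+ 2 - _)).
  by rewrite /traceLevel -sum1dep_card big_mkcondr.
by rewrite cardsE.
Qed.

(** * The isogeny of degree 3 *)

(** The a for which t^2 is a root of x^4 + x^3 + a^2, the polynomial of the
    abscissas of the points of order 3 on y^2 + xy = x^3 + a^2. *)
Definition isogCoef (t : F) := t ^+ 3 * (t + 1).

Lemma isogCoefS t : isogCoef (t + 1) = t * (t + 1) ^+ 3.
Proof. by rewrite /isogCoef -addrA addrr_pchar2 // addr0 mulrC. Qed.

(** The left-hand side is the trace of A^3 / B^2, which governs how the cubic
    y^3 + A y + B factors over F, for A = x + s^2 and B = x. It occurs twice:
    with s = t for the fibre of the isogeny through x, and with s = t + 1 for
    the fibre above x. *)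
Lemma absTrace_cubic s x : x != 0 ->
  Tr ((x + s ^+ 2) ^+ 3 / x ^+ 2) = Tr (x + isogCoef s / x) + Tr s.
Proof.
move=> x0.
have -> : (x + s ^+ 2) ^+ 3 / x ^+ 2 =
    x + s ^+ 2 + s ^+ 4 / x + (s ^+ 3 / x) ^+ 2 by field: three1.
have -> : x + isogCoef s / x = x + s ^+ 4 / x + s ^+ 3 / x.
  by rewrite /isogCoef; field.
rewrite !absTraceD !absTrace_sqr; ring.
Qed.

(** Velu's formula for the quotient by the points of order 3 of abscissa t^2,
    read on abscissas; see isogE for its usual shape. *)
Definition isog (t x : F) := x * ((x + t ^+ 2 + t) / (x + t ^+ 2)) ^+ 2.

(** The sum of polar parts at t^2 has the Artin-Schreier form p^2 + p, which is
    why it does not contribute to the trace. *)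
Lemma isogE t x : x + t ^+ 2 != 0 ->
  isog t x = x + ((t ^+ 2 / (x + t ^+ 2)) ^+ 2 + t ^+ 2 / (x + t ^+ 2)).
Proof.
rewrite /isog; set u := x + _ => u0.
have xE : x = u + t ^+ 2 by rewrite /u -addrA addrr_pchar2 ?addr0.
by clearbody u; field: xE two0 three1.
Qed.

(** The counterpart of isogE for the second term of the trace: the pole of 1/R
    at t^2 + t also contributes an element n^2 + n. *)
Lemma isogCoef_isog t x : x != 0 -> x + t ^+ 2 != 0 -> x + t ^+ 2 + t != 0 ->
  isogCoef (t + 1) / isog t x = isogCoef t / x +
    ((t * (t + 1) / (x + t ^+ 2 + t)) ^+ 2 + t * (t + 1) / (x + t ^+ 2 + t)).
Proof.
rewrite /isog; set u := x + _; set v := u + t => x0 u0 v0.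
have xE : x = v + t * (t + 1) by rewrite /v /u; ring: two0.
have uE : (t + 1) * u = t * v + x by rewrite /v /u; ring: two0.
clearbody u v.
rewrite isogCoefS /isogCoef; apply: (mulIf (mulf_neq0 x0 (expf_neq0 2 v0))).
transitivity (t * (t + 1) * ((t + 1) * u) ^+ 2).
  by field; rewrite u0 v0 x0.
have -> : ((t + 1) * u) ^+ 2 = t ^+ 2 * v ^+ 2 + x * x.
  by rewrite uE; ring: two0.
by rewrite {2}xE; field; rewrite v0 x0.
Qed.

Lemma absTrace_isog t x : x != 0 -> x + t ^+ 2 != 0 -> x + t ^+ 2 + t != 0 ->
  Tr (isog t x + isogCoef (t + 1) / isog t x) = Tr (x + isogCoef t / x).
Proof.
move=> x0 u0 v0; rewrite isogCoef_isog // isogE // addrACA absTraceD.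
by rewrite [Tr (_ + (_ + _))]absTraceD !absTrace_ArtinSchreier !addr0.
Qed.

(** The finite pole t^2 and the nonzero zero t^2 + t of R both lie in the level
    set of Tr(t), so R is defined and nonzero on the other one. *)
Lemma isog_dom t x : x \in traceLevel (isogCoef t) (Tr t + 1) ->
  [/\ x != 0, x + t ^+ 2 != 0 & x + t ^+ 2 + t != 0].
Proof.
rewrite inE => /andP[x0 /eqP Trx].
have Trx_neq : Tr (x + isogCoef t / x) <> Tr (t + (t ^+ 2 + t ^+ 2)).
  rewrite Trx addrr_pchar2 // addr0 => /eqP.
  by rewrite addrC -subr_eq0 addrK oner_eq0.
split=> //; apply/eqP.
  move/char2_eq=> xE; apply: Trx_neq; congr Tr; move: x0.
  rewrite xE /isogCoef => x0; by field; rewrite expf_eq0 /= in x0.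
rewrite -addrA => /char2_eq xE; apply: Trx_neq; congr Tr; move: x0.
rewrite xE /isogCoef => x0; by field.
Qed.

(** The abscissas other than x in the fibre of R through x are the roots of a
    quadratic polynomial; after an affine change of variable it is
    z^2 + z = u^3 / x^2 with u = x + t^2, so that a rational root makes the
    trace of the right-hand side vanish. *)
Lemma isog_inj t : t != 0 ->
  {in traceLevel (isogCoef t) (Tr t + 1) &, injective (isog t)}.
Proof.
move=> t0 x y Sx Sy.
have [x0 u0 _] := isog_dom Sx; have [_ u'0 _] := isog_dom Sy.
rewrite !isogE //; set u := x + _ in u0 *; set u' := y + _ in u'0 * => eq_isog.
apply/eqP/idPn=> neq_xy.
have fiber_eq : u ^+ 2 * u' ^+ 2 + t ^+ 2 * (u * u') + t ^+ 4 * (u + u') = 0.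
  have d0 : u + u' != 0.
    by apply: contraNneq neq_xy => /char2_eq/addIr->.
  apply: (mulfI d0); rewrite mulr0.
  have xyE : x + y = u + u' by rewrite /u /u'; ring: two0.
  move: eq_isog; clearbody u u' => eq_isog.
  transitivity ((u * u') ^+ 2 * (x + y + ((t ^+ 2 / u) ^+ 2 + t ^+ 2 / u) +
                ((t ^+ 2 / u') ^+ 2 + t ^+ 2 / u'))).
    by rewrite xyE; field: two0; rewrite u0 u'0.
  by rewrite (addrAC x) eq_isog; ring: two0.
have xE : x = u + t ^+ 2 by rewrite /u -addrA addrr_pchar2 ?addr0.
have : Tr (u ^+ 3 / x ^+ 2) = 0.
  (* The change of variable that brings the quadratic equation fiber_eq in u'
     to Artin-Schreier form. *)
  pose z := u ^+ 2 * u' / (t ^+ 2 * x).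
  rewrite -(absTrace_ArtinSchreier z); congr Tr.
  have -> : z ^+ 2 + z = u ^+ 2 * (u ^+ 2 * u' ^+ 2 + t ^+ 2 * x * u') /
                         (t ^+ 4 * x ^+ 2).
    by rewrite /z; field; rewrite x0.
  have -> : u ^+ 2 * u' ^+ 2 + t ^+ 2 * x * u' = t ^+ 4 * u.
    by apply: char2_eq; rewrite -fiber_eq xE; ring.
  by field; rewrite t0 x0.
rewrite absTrace_cubic //; move: Sx; rewrite inE x0 => /eqP->.
by rewrite addrAC addrr_pchar2 // add0r => /eqP; rewrite oner_eq0.
Qed.

Lemma isog_traceLevel t x : x \in traceLevel (isogCoef t) (Tr t + 1) ->
  isog t x \in traceLevel (isogCoef (t + 1)) (Tr t + 1).
Proof.
move=> Sx; have [x0 u0 v0] := isog_dom Sx; move: Sx.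
rewrite !inE absTrace_isog // => /andP[_ ->].
by rewrite /isog mulf_neq0 ?expf_neq0 ?mulf_neq0 ?invr_neq0.
Qed.

Lemma leq_card_traceLevel t : t != 0 ->
  (#|traceLevel (isogCoef t) (Tr t + 1)%R|
     <= #|traceLevel (isogCoef (t + 1)%R) (Tr t + 1)%R|)%N.
Proof.
move=> t0; rewrite -(card_in_imset (isog_inj t0)) subset_leq_card //.
by apply/subsetP=> _ /imsetP[x Sx ->]; apply: isog_traceLevel.
Qed.

(** * Surjectivity when 1 has trace 1 *)

(** A primitive cube root of unity w would give 1 = w^2 + w, of trace 0. *)
Lemma cube_surj : Tr 1 = 1 -> forall x : F, exists y, x = y ^+ 3.
Proof.
move=> Tr1; have inj3 : injective (fun y : F => y ^+ 3).
  move=> x y /eqP eq3; apply/char2_eq/eqP.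
  have : (x + y) * (x ^+ 2 + x * y + y ^+ 2) == 0.
    have -> : (x + y) * (x ^+ 2 + x * y + y ^+ 2) = x ^+ 3 + y ^+ 3.
      by ring: two0.
    by rewrite (eqP eq3) addrr_pchar2.
  rewrite mulf_eq0 => /orP[-> // | /eqP xy0].
  have [y0 | y0] := eqVneq y 0.
    by move: eq3; rewrite y0 expr0n expf_eq0 addr0.
  have := absTrace_ArtinSchreier (x / y); suff -> : (x / y) ^+ 2 + x / y = 1.
    by move/eqP; rewrite Tr1 oner_eq0.
  apply: char2_eq.
  have -> : (x / y) ^+ 2 + x / y + 1 = (x ^+ 2 + x * y + y ^+ 2) / y ^+ 2.
    by field.
  by rewrite xy0 mul0r.
by move=> x; exists (invF inj3 x); rewrite (f_invF inj3).
Qed.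

(** Cardano's formula: e + A/e is a root as soon as e^3 solves the resolvent
    U^2 + B U = A^3, which U = B w brings to Artin-Schreier form. *)
Lemma cubic_root A B : Tr 1 = 1 -> B != 0 -> Tr (A ^+ 3 / B ^+ 2) = 0 ->
  exists y, y ^+ 3 + A * y + B = 0.
Proof.
move=> Tr1 B0 /absTrace_Hilbert90[w wE].
(* For A = 0 the root w = 0 would give e = 0; then w = 1 is the other root.    *)
have {w wE} [w w0 wE] : exists2 w, w != 0 & A ^+ 3 / B ^+ 2 = w ^+ 2 + w.
  have [w0 | w0] := eqVneq w 0; last by exists w.
  exists 1; first exact: oner_neq0.
  by rewrite wE w0 expr1n expr0n addr0 addrr_pchar2.
have [e eE] := cube_surj Tr1 (B * w).
have e0 : e != 0.
  by apply: contraNneq (mulf_neq0 B0 w0) => e0; rewrite eE e0 expr0n.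
have A3 : A ^+ 3 = (e ^+ 3) ^+ 2 + B * e ^+ 3.
  by rewrite -eE -[LHS](divfK (expf_neq0 2 B0)) wE; ring.
exists (e + A / e).
(* The multiple of 2 makes this an identity over the integers.                *)
have -> : (e + A / e) ^+ 3 + A * (e + A / e) + B =
    e ^+ 3 + A ^+ 3 / e ^+ 3 + B + 2%:R * (2%:R * A * (e + A / e)) by field.
by rewrite two0 mul0r addr0 A3; field: two0.
Qed.

(** In the coordinate y = x / (x + t^2), the equation R(x) = x' becomes the
    cubic y^3 + (x' + (t + 1)^2) y + x' = 0 without quadratic term. *)
Lemma isog_surj t x' : Tr 1 = 1 -> t != 0 ->
  x' \in traceLevel (isogCoef (t + 1)) (Tr t + 1) ->
  exists2 x, x \in traceLevel (isogCoef t) (Tr t + 1) & isog t x = x'.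
Proof.
rewrite inE => Tr1 t0 /andP[x'0 /eqP Trx'].
have TrAB : Tr ((x' + (t + 1) ^+ 2) ^+ 3 / x' ^+ 2) = 0.
  by rewrite absTrace_cubic // Trx' absTraceD Tr1 addrr_pchar2.
have [y yE] := cubic_root Tr1 x'0 TrAB.
have y0 : y != 0.
  apply: contraNneq x'0 => y0; move: yE.
  by rewrite y0 expr0n mulr0 !add0r => ->.
have y10 : y + 1 != 0.
  apply: contraNneq t0 => /char2_eq y1.
  have /eqP : t ^+ 2 = 0; last by rewrite expf_eq0.
  by rewrite -yE y1; ring: two0.
pose x := t ^+ 2 * y / (y + 1).
have x0 : x != 0 by rewrite !mulf_neq0 ?invr_neq0 ?expf_neq0.
have uE : x + t ^+ 2 = t ^+ 2 / (y + 1) by rewrite /x; field: two0 three1.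
have u0 : x + t ^+ 2 != 0 by rewrite uE mulf_neq0 ?invr_neq0 ?expf_neq0.
have isog_x : isog t x = x'.
  have -> : isog t x = y * (t + (y + 1)) ^+ 2 / (y + 1).
    by rewrite /isog uE /x; field; rewrite y10 t0.
  apply: (mulIf y10); rewrite divfK //; apply: char2_eq.
  by rewrite -[RHS]yE; ring: two0.
exists x => //; rewrite inE x0 -absTrace_isog ?isog_x ?Trx' ?eqxx //.
apply: contraNneq x'0 => v0.
by rewrite -isog_x /isog v0 mul0r expr0n mulr0.
Qed.

(** * Comparison of the Kloosterman sums *)

Lemma isogCoefK t : isogCoef (t + 1 + 1) = isogCoef t.
Proof. by rewrite -addrA addrr_pchar2 ?addr0. Qed.

Lemma card_traceLevel_eq t : t != 0 -> t + 1 != 0 ->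
  #|traceLevel (isogCoef t) (Tr t + 1)|
    = #|traceLevel (isogCoef (t + 1)) (Tr t + 1)|.
Proof.
move=> t0 t10; apply/eqP; rewrite eqn_leq leq_card_traceLevel //=.
have [Tr1 | Tr1] := absTrace01 1.
  by have := leq_card_traceLevel t10; rewrite isogCoefK absTraceD Tr1 addr0.
rewrite -(card_in_imset (isog_inj t0)) subset_leq_card //.
apply/subsetP=> x' /(isog_surj Tr1 t0)[x Sx <-]; exact: imset_f.
Qed.

Lemma Kloosterman_isogCoef t : t != 0 -> t + 1 != 0 ->
  Kloosterman cardF (isogCoef t) = Kloosterman cardF (isogCoef (t + 1)).
Proof.
move=> t0 t10; have Tr01 : Tr t + 1 = 0 \/ Tr t + 1 = 1.
  case: (absTrace01 t) => ->; first by right; rewrite add0r.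
  by left; rewrite addrr_pchar2.
rewrite !(@Kloosterman_traceLevel _ (Tr t + 1)) ?card_traceLevel_eq //.
  by rewrite /isogCoef -addrA addrr_pchar2 // addr0 mulf_neq0 ?expf_neq0.
by rewrite /isogCoef mulf_neq0 ?expf_neq0.
Qed.

End KloostermanIdentity.

Theorem theorem2 (m : nat) (F : finFieldType) (m_gt0 : (0 < m)%N)
    (cardF : #|F| = (2 ^ m)%N) (b c : F) :
  let k1 := b ^+ 2 + c + 1 in
  let k2 := b ^+ 2 + b + c + fsqrt c in
  k1 * k2 != 0 ->
  Kloosterman cardF (k1 * k2) = Kloosterman cardF (k1 * k2 + k2).
Proof.
have char2 : 2%N \in [pchar F] := card_finPcharP cardF isT.
have two0 : 2%:R = 0 :> F := pcharf0 char2.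
move=> k1 k2 k12; pose t := b + fsqrt c.
have k2E : k2 = t * (t + 1).
  by rewrite /k2 -{1}(fsqrtK c char2) /t; ring: two0.
have k1E : k1 = (t + 1) ^+ 2.
  by rewrite /k1 -(fsqrtK c char2) /t; ring: two0.
have := k12; rewrite k1E k2E !mulf_eq0 !negb_or => /and3P[_ t0 t10].
have -> : (t + 1) ^+ 2 * (t * (t + 1)) = isogCoef (t + 1).
  by rewrite (isogCoefS cardF); ring.
have -> : isogCoef (t + 1) + t * (t + 1) = isogCoef t.
  have -> : isogCoef (t + 1) + t * (t + 1)
            = isogCoef t + 2%:R * (t * (t + 1) ^+ 2).
    by rewrite (isogCoefS cardF) /isogCoef; ring.
  by rewrite two0 mul0r addr0.
by rewrite (Kloosterman_isogCoef cardF t0 t10).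
Qed.
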